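(* Let $\varphi$ be a convex $\varphi$-function and $0<\nu\le1$. Then $$Lip(\nu,\varphi)\subseteq\widetilde{Lip}(\nu,\varphi).$$
   Context: Let $I=[a,b]\subset\mathbb R$ with $a<b$. A $\varphi$-function is a continuous non-decreasing $\varphi:[0,\infty)\to[0,\infty)$ with $\varphi(0)=0$, $\varphi(u)>0$ for $u>0$, $\lim_{u\to\infty}\varphi(u)=+\infty$. For measurable $f$ on $I$, $I^\varphi[f]:=\int_I\varphi(|f(x)|)\,dx$; $L^\varphi(I)$ is the set of measurable $f$ on $I$ with $I^\varphi[\lambda f]<+\infty$ for some $\lambda>0$. The Luxemburg norm is $\|f\|_\varphi:=\inf\{u>0: I^\varphi[f/u]\le1\}$. Functions on $I$ are extended to $\mathbb R$ as $(b-a)$-periodic functions, and for $\delta>0$, $$\omega(f,\delta)_\varphi:=\sup_{|h|\le\delta}\|f(\cdot+h)-f(\cdot)\|_\varphi,\qquad\widetilde\omega(f,\delta)_\varphi:=\sup_{|h|\le\delta}I^\varphi[f(\cdot+h)-f(\cdot)].$$ For $0<\nu\le1$: $$Lip(\nu,\varphi):=\{f\in L^\varphi(I):\omega(f,\delta)_\varphi=\mathcal O(\delta^\nu)\text{ as }\delta\to0^+\},$$ $$\widetilde{Lip}(\nu,\varphi):=\{f\in L^\varphi(I):\exists\,\lambda>0\text{ such that }\widetilde\omega(\lambda f,\delta)_\varphi=\mathcal O(\delta^\nu)\text{ as }\delta\to0^+\}.$$ *)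

(* Defs.v *)
From HB Require Import structures.
From mathcomp Require Import all_boot all_order all_algebra.
From mathcomp Require Import all_classical all_reals all_analysis.

Set Implicit Arguments.
Unset Strict Implicit.
Unset Printing Implicit Defensive.

Import Order.TTheory GRing.Theory Num.Theory.
Import numFieldNormedType.Exports.

Local Open Scope classical_set_scope.
Local Open Scope ring_scope.

(* The real line with the sigma-algebra of all Lebesgue measurable sets: the
   domain of [completed_lebesgue_measure].  The default measurable structure on
   [R] in the library only has the Borel sets. *)
Notation lebesgueR R :=
  (caratheodory_type (T := ocitv_type R) (wlength (@idfun R))^*%mu).

Section OrliczLipschitz.
Context {R : realType}.

(* A function on [0, +oo[ is a total function on R whose values at negative
   reals play no role.  That phi maps [0, +oo[ into itself follows from the
   third and fourth conditions. *)
Definition phi_function (phi : R -> R) : Prop :=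
  [/\ {within `[0, +oo[, continuous phi},
      {in `[0, +oo[ &, {homo phi : u v / u <= v}},
      phi 0 = 0,
      (forall u, 0 < u -> 0 < phi u)
    & phi u @[u --> +oo] --> +oo].

Definition convex_phi (phi : R -> R) : Prop :=
  convex_function (E := R^o) `[0, +oo[ phi.

(* A function on I = [a, b] is a total function on R; only its values on [a, b]
   are used below. *)
Definition modular (a b : R) (phi : R -> R) (f : R -> R) : \bar R :=
  (\int[@completed_lebesgue_measure R]_(x in `[a, b]) (phi `|f x|)%:E)%E.

Definition Lphi (a b : R) (phi : R -> R) : set (R -> R) :=
  [set f | measurable_fun (`[a, b] : set (lebesgueR R)) (f : lebesgueR R -> R) /\
           exists2 lambda : R, 0 < lambda &
             (modular a b phi (fun x => lambda * f x)%R < +oo)%E].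

(* Valued in \bar R, with the infimum of the empty set equal to +oo. *)
Definition luxemburg (a b : R) (phi : R -> R) (f : R -> R) : \bar R :=
  ereal_inf [set u%:E | u in
    [set u : R | 0 < u /\ (modular a b phi (fun x => f x / u)%R <= 1)%E]].

(* The (b - a)-periodic function equal to f on [a, b[.  When f a <> f b there
   is no periodic function equal to f on all of [a, b]; the value at b, which is
   irrelevant up to a null set, is then dropped. *)
Definition periodic_ext (a b : R) (f : R -> R) (x : R) : R :=
  f (x - (b - a) * (Num.floor ((x - a) / (b - a)))%:~R).

Definition increment (a b : R) (f : R -> R) (h : R) (x : R) : R :=
  periodic_ext a b f (x + h) - periodic_ext a b f x.

Definition omega (a b : R) (phi : R -> R) (f : R -> R) (delta : R) : \bar R :=
  ereal_sup [set luxemburg a b phi (increment a b f h) | h in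
    [set h : R | `|h| <= delta]].

Definition omegaw (a b : R) (phi : R -> R) (f : R -> R) (delta : R) : \bar R :=
  ereal_sup [set modular a b phi (increment a b f h) | h in
    [set h : R | `|h| <= delta]].

(* w(x) = O(x^nu) as x -> 0+, for w with extended real values: in
   particular w has to be finite near 0+. *)
Definition bigO_pow0 (nu : R) (w : R -> \bar R) : Prop :=
  (\forall x \near 0^'+, w x \is a fin_num) /\
  (fun x : R => fine (w x) : R^o) =O_ (0^'+) (fun x : R => x `^ nu : R^o).

Definition Lip (a b nu : R) (phi : R -> R) : set (R -> R) :=
  [set f | Lphi a b phi f /\ bigO_pow0 nu (omega a b phi f)].

Definition Lipw (a b nu : R) (phi : R -> R) : set (R -> R) :=
  [set f | Lphi a b phi f /\
     exists2 lambda : R, 0 < lambda &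
       bigO_pow0 nu (omegaw a b phi (fun x => lambda * f x))].

End OrliczLipschitz.

(* Main.v *)
Require Import Defs.
From mathcomp Require Import all_boot all_order all_algebra.
From mathcomp Require Import all_classical all_reals all_analysis.

Set Implicit Arguments.
Unset Strict Implicit.
Unset Printing Implicit Defensive.

Import Order.TTheory GRing.Theory Num.Theory.
Import numFieldNormedType.Exports.

Local Open Scope classical_set_scope.
Local Open Scope ring_scope.

(** Convexity and [phi 0 = 0] give [phi (t * u) <= t * phi u] for [t] in [0, 1],
    hence the modular satisfies [I (t g) <= t * I g].  If [`|h| <= x] and
    [omega f x <= c * x `^ nu], the Luxemburg norm of the increment [g] of [f] by
    [h] is less than [(c + 1) * x `^ nu], so [I (g / u) <= 1] for some
    [u < (c + 1) * x `^ nu].  Put [lambda := (c + 1)^-1].  When [x <= 1] the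
    factor [lambda * u] is at most [x `^ nu <= 1], and therefore
    [I (lambda g) = I ((lambda * u) (g / u)) <= lambda * u <= x `^ nu].
    Since [lambda] depends neither on [x] nor on [h], taking the supremum over
    [h] gives the claim.  The core is [modular_scale_le] and
    [luxemburg_lt_modular_le]. *)

Section Integral.
Local Open Scope ereal_scope.
Import HBNNSimple.

(** The integral of a nonnegative function is the supremum of the integrals of
    the simple functions below it, and dividing by [k] sends the simple functions
    below [g] to simple functions below [f].  This route applies to the
    increments of [f] before their Lebesgue measurability is established. *)
Lemma ge0_le_integralZl_nonmeasurable (d : measure_display)
    (T : measurableType d) (R : realType) (mu : {measure set T -> \bar R})
    (D : set T) (k : R) (f g : T -> \bar R) :
  (0 < k)%R -> (forall x, D x -> 0 <= f x) -> (forall x, D x -> 0 <= g x) ->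
  (forall x, D x -> g x <= k%:E * f x) ->
  \int[mu]_(x in D) g x <= k%:E * \int[mu]_(x in D) f x.
Proof.
move=> k0 f0 g0 gkf; rewrite !ge0_integralE//.
apply: ge_ereal_sup => _ [h hg <-].
have ki0 : (0 <= k^-1)%R by rewrite invr_ge0 ltW.
rewrite -lee_pdivrMl// -sintegralrM.
apply: ereal_sup_ubound; exists (scale_nnsfun h ki0) => //= x.
rewrite EFinM lee_pdivrMl// (le_trans (hg x))// !patchE.
by case: ifPn => [/set_mem Dx|_]; [exact: gkf|rewrite mule0].
Qed.

End Integral.

Section ConvexModular.
Context {R : realType}.
Variables (a b : R) (phi : R -> R).
Hypotheses (hphi : phi_function phi) (hconv : convex_phi phi).

Lemma phi_ge0 (u : R) : 0 <= u -> 0 <= phi u.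
Proof.
case: hphi => _ _ phi0 phi_gt0 _; rewrite le_eqVlt => /predU1P[<-|/phi_gt0/ltW//].
by rewrite phi0.
Qed.

(** This is convexity on the segment from [0] to [u], whose lower end
    contributes [phi 0 = 0]. *)
Lemma phi_scale_le (t u : R) : 0 <= t <= 1 -> 0 <= u -> phi (t * u) <= t * phi u.
Proof.
move=> /andP[t0 t1] u0; have phi0 : phi 0 = 0 by case: hphi.
have u_in : u \in (`[0, +oo[%classic : set R) by rewrite inE/= in_itv/= u0.
have z_in : 0 \in (`[0, +oo[%classic : set R) by rewrite inE/= in_itv/= lexx.
have : phi (t * u + (1 - t) * 0) <= t * phi u + (1 - t) * phi 0 :=
  hconv (Itv01 t0 t1) u_in z_in.
by rewrite phi0 !mulr0 !addr0.
Qed.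

Lemma modular_ge0 (g : R -> R) : (0 <= modular a b phi g)%E.
Proof. by apply: integral_ge0 => x _; rewrite lee_fin phi_ge0. Qed.

Lemma modular_scale_le (t : R) (g : R -> R) : 0 < t <= 1 ->
  (modular a b phi (fun x => (t * g x)%R) <= t%:E * modular a b phi g)%E.
Proof.
move=> /andP[t0 t1]; apply: ge0_le_integralZl_nonmeasurable => // x _.
- by rewrite lee_fin phi_ge0.
- by rewrite lee_fin phi_ge0.
- by rewrite -EFinM lee_fin normrM gtr0_norm// phi_scale_le// ltW.
Qed.

(** The norm is an infimum: a strict upper bound [r] on it yields some [u < r]
    with [I (g / u) <= 1], and [l g] is [g / u] shrunk by the factor
    [l * u <= 1]. *)
Lemma luxemburg_lt_modular_le (l r : R) (g : R -> R) : 0 < l -> l * r <= 1 ->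
  (luxemburg a b phi g < r%:E)%E ->
  (modular a b phi (fun x => (l * g x)%R) <= (l * r)%:E)%E.
Proof.
move=> l0 lr1 /ereal_inf_lt[_ [u [u0 gu1] <-]]; rewrite lte_fin => ur.
have lur : l * u <= l * r by rewrite ler_pM2l// ltW.
have -> : (fun x => l * g x) = (fun x => (l * u) * (g x / u)).
  by apply/funext => x; rewrite mulrACA divff ?mulr1 ?gt_eqF//.
apply: (le_trans (@modular_scale_le _ (fun x => g x / u) _)).
  by rewrite mulr_gt0//= (le_trans lur).
apply: (@le_trans _ _ (l * u)%:E); last by rewrite lee_fin.
by rewrite -[leRHS]mule1 lee_pmul2l// lte_fin mulr_gt0.
Qed.

End ConvexModular.

Theorem proposition6p2 (R : realType) (a b : R) (phi : R -> R) (nu : R)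
    (hab : a < b) (hphi : phi_function phi) (hconv : convex_phi phi)
    (hnu : 0 < nu <= 1) :
  Lip a b nu phi `<=` Lipw a b nu phi.
Proof.
move=> f [fL [w_fin /eqO_exP[c c0 w_le]]]; split=> //.
have K0 : 0 < c + 1 by rewrite addr_gt0.
(* Taking [c + 1] instead of [c] makes the bound on the norm strict, so that it
   is witnessed by an element of the set whose infimum is the norm. *)
exists (c + 1)^-1; first by rewrite invr_gt0.
have bound : \forall x \near 0^'+,
    (0 <= omegaw a b phi (fun y => (c + 1)^-1 * f y)%R x <= (x `^ nu)%:E)%E.
  near=> x.
  have x0 : 0 < x by near: x; exact: nbhs_right_gt.
  have x1 : x <= 1 by near: x; exact: nbhs_right_le.
  have wx_fin : omega a b phi f x \is a fin_num by near: x.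
  have wx : (omega a b phi f x < ((c + 1) * x `^ nu)%:E)%E.
    have : `|fine (omega a b phi f x)| <= c * `|x `^ nu| by near: x.
    rewrite (ger0_norm (powR_ge0 _ _)) => /(le_trans (ler_norm _)) h.
    rewrite -(fineK wx_fin) lte_fin (le_lt_trans h)// ltr_pM2r ?powR_gt0//.
    by rewrite ltrDl.
  have modE h : increment a b (fun y => (c + 1)^-1 * f y) h =
      (fun y => (c + 1)^-1 * increment a b f h y).
    by apply/funext => y; rewrite /increment /periodic_ext -mulrBr.
  (* The supremum is nonnegative because its index set contains the shift 0. *)
  apply/andP; split.
    apply: le_trans (ereal_sup_ubound _); last first.
      by exists 0 => //=; rewrite normr0 ltW.
    exact: modular_ge0.
  apply: ge_ereal_sup => _ [h /= hx <-]; rewrite modE.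
  have -> : x `^ nu = (c + 1)^-1 * ((c + 1) * x `^ nu).
    by rewrite mulKf// gt_eqF.
  apply: luxemburg_lt_modular_le => //; first by rewrite invr_gt0.
    rewrite mulKf ?gt_eqF//.
    by rewrite -(powRr0 x) ger_powR ?x0 ?x1// ltW//; case/andP: hnu.
  apply: le_lt_trans wx; apply: ereal_sup_ubound; by exists h.
split.
  near=> x.
  have /andP[w0 wx] : (0 <= omegaw a b phi (fun y => (c + 1)^-1 * f y)%R x
      <= (x `^ nu)%:E)%E by near: x.
  by rewrite ge0_fin_numE// (le_lt_trans wx) ?ltry.
apply/eqO_exP; exists 1 => //; near=> x.
have /andP[w0 wx] : (0 <= omegaw a b phi (fun y => (c + 1)^-1 * f y)%R x
    <= (x `^ nu)%:E)%E by near: x.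
rewrite mul1r !ger0_norm ?powR_ge0 ?fine_ge0//.
by rewrite -lee_fin fineK// ge0_fin_numE// (le_lt_trans wx) ?ltry.
Unshelve. all: by end_near. Qed.
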